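(* Let $\mathcal{D}$ be a finite set with $N=|\mathcal{D}|$, let $\mathbf{R}=\{\mathbf{r}_1,\dots,\mathbf{r}_\ell\}\subseteq[0,1]$ be finite, and let $\mathbf{q}\in\mathbf{R}^{\mathcal{D}}$ with $\sum_x\mathbf{q}_x\le1$. Let $\phi$ be a profile with distinct non-zero frequencies $\mathbf{m}_1,\dots,\mathbf{m}_k$ having multiplicities $\phi_1,\dots,\phi_k$, with $\sum_{j\ge1}\phi_j\le N$; set $\mathbf{m}_0=0$, $\phi_0=N-\sum_{j\ge1}\phi_j$. Let $\mathbf{A}$ be the $\mathcal{D}\times\mathcal{D}$ matrix $\mathbf{A}_{x,y}=\mathbf{q}_x^{\mathbf{f}_y}$. Then $$\log\mathrm{perm}(\mathbf{A})\le O\big(k\log\tfrac{N}{k}\big)+\max_{\mathbf{S}\in\mathbf{Z}^{\mathbf{q},\phi}_{\mathbf{R}}}\mathbf{h}(\mathbf{S}),$$ with an absolute constant in $O(\cdot)$.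
   Context: Here $\mathbf{f}\in\mathbb{Z}_{\ge0}^{\mathcal{D}}$ is a frequency vector with exactly $\phi_j$ elements $y$ having $\mathbf{f}_y=\mathbf{m}_j$ for each $j\in[0,k]$. $\ell^{\mathbf{q}}_i=|\{y:\mathbf{q}_y=\mathbf{r}_i\}|$. $\mathbf{Z}^{\mathbf{q},\phi}_{\mathbf{R}}$ is the set of $\mathbf{S}\in\mathbb{R}_{\ge0}^{\ell\times(k+1)}$ (columns indexed by $[0,k]$) with row sums $\sum_j\mathbf{S}_{i,j}=\ell^{\mathbf{q}}_i$ and column sums $\sum_i\mathbf{S}_{i,j}=\phi_j$ for $j\in[0,k]$. $\mathbf{h}(\mathbf{S})=\sum_{i,j}\mathbf{S}_{i,j}\log\frac{\mathbf{r}_i^{\mathbf{m}_j}}{\mathbf{S}_{i,j}}+\sum_i(\sum_j\mathbf{S}_{i,j})\log(\sum_j\mathbf{S}_{i,j})+\sum_{j=0}^k\phi_j\log\phi_j-\sum_{j=0}^k\phi_j$ (conventions $0\log0=0$, $0^0=1$, $\log0=-\infty$).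
   Formalization: As stated the bound fails (N=k=1, q=1, f=1: log perm=0, log(N/k)=0, max h=-1) and k=0 is undefined; the formal theorem takes k≥1 and proves error C·k(1+log(N/k)) always, and C·k·log(N/k) when 2k≤N, with one absolute C. *)

(* Defs.v *)
From HB Require Import structures.
From mathcomp Require Import all_boot all_order all_fingroup all_algebra.
From mathcomp Require Import all_classical all_reals all_analysis.

Set Implicit Arguments.
Unset Strict Implicit.
Unset Printing Implicit Defensive.

Import Order.TTheory GRing.Theory Num.Theory.

Local Open Scope classical_set_scope.
Local Open Scope ring_scope.

(* The index type of rows and columns is an arbitrary finite type. *)
Definition permanent (R : comNzRingType) (D : finType) (A : D -> D -> R) : R :=
  \sum_(s : {perm D}) \prod_(x : D) A x (s x).

(* m and phi list the k distinct non-zero frequencies and their multiplicities;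
   freq and mult extend them to the index range [0, k] by
   m_0 = 0 and phi_0 = N - \sum_(j >= 1) phi_j. *)
Definition freq (k : nat) (m : 'I_k -> nat) (j : 'I_k.+1) : nat :=
  if unlift ord0 j is Some i then m i else 0%N.

(* The subtraction truncates; it is only meant for \sum_i phi i <= N. *)
Definition mult (N k : nat) (phi : 'I_k -> nat) (j : 'I_k.+1) : nat :=
  if unlift ord0 j is Some i then phi i else (N - \sum_(i < k) phi i)%N.

Section SinkhornObjective.
Variables (R : realType) (D : finType) (l k : nat).
Variables (r : 'I_l -> R) (q : D -> R) (m phi : 'I_k -> nat).

Definition level_size (i : 'I_l) : nat := #|[set y : D | q y == r i]%SET|.

Definition Zset : set 'M[R]_(l, k.+1) :=
  [set S | [/\ forall i j, 0 <= S i j,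
               forall i, \sum_j S i j = (level_size i)%:R
             & forall j, \sum_i S i j = (mult #|D| phi j)%:R]].

(* lne is -oo at 0, and 0 * -oo = 0 in \bar R: an entry S i j = 0 contributes 0,
   while S i j > 0 with r i ^+ freq m j = 0 gives -oo.
   Elsewhere the real ln is used; ln 0 is finite, so 0 * ln 0 = 0. *)
Definition hfun (S : 'M[R]_(l, k.+1)) : \bar R :=
  (\sum_(i < l) \sum_(j < k.+1)
      (S i j)%:E * lne (r i ^+ freq m j / S i j)%:E
   + (\sum_(i < l) (\sum_(j < k.+1) S i j) * ln (\sum_(j < k.+1) S i j))%:E
   + (\sum_(j < k.+1) (mult #|D| phi j)%:R * ln (mult #|D| phi j)%:R)%:E
   - (\sum_(j < k.+1) (mult #|D| phi j)%:R)%:E)%E.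

End SinkhornObjective.

(* Main.v *)
(* Draw a permutation [s] with probability proportional to its term in the
   permanent and let S_ij be the expected number of [x] of level r_i with
   f (s x) = m_j.  Then S lies in Z, and log perm(A) is the entropy of [s] plus
   sum_ij S_ij log (r_i ^ m_j).  Since S only records the class of s x, Gibbs'
   inequality bounds the entropy by that of the product measure with the same
   one-point marginals plus log (prod_j phi_j!), the number of permutations
   inducing a given assignment of classes.  Hence
   log perm(A) <= h(S) + sum_j (log phi_j! - phi_j log phi_j + phi_j), and each
   of the last terms is at most 1 + log phi_j, where
   log phi_j <= log (N/k) + k phi_j / N - 1 for j >= 1. *)
Require Import Defs.
From mathcomp Require Import all_boot all_order all_fingroup all_algebra.
From mathcomp Require Import all_classical all_reals all_analysis.
From mathcomp Require Import ring lra.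

Set Implicit Arguments.
Unset Strict Implicit.
Unset Printing Implicit Defensive.

Import Order.TTheory GRing.Theory Num.Theory.
Import numFieldNormedType.Exports.

Local Open Scope classical_set_scope.
Local Open Scope ring_scope.

(** * The Stirling error terms *)

Lemma ln_le_subr1 (R : realType) (x : R) : 0 < x -> ln x <= x - 1.
Proof. by move=> x0; rewrite -[x in ln x](subrKC 1) le_ln1Dx// ltrBDl subrr. Qed.

(** By induction: the step from [n] needs [(n + 1) * (ln (n + 1) - ln n) >= 1], which is
    [ln x <= x - 1] at [x = n / (n + 1)]. The case [n = 0] relies on [ln 0] being 0. *)
Lemma ln_fact_le (R : realType) (n : nat) :
  ln n`!%:R - n%:R * ln n%:R + n%:R <= 1 + ln n%:R :> R.
Proof.
elim: n => [|n IH]; first by rewrite fact0 ln1 mul0r ln0// !addr0 subr0 ler01.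
have [->|n0] := eqVneq n 0%N; first by rewrite ln1 mulr0 subrr add0r addr0.
have n1 : 0 < n%:R :> R by rewrite ltr0n lt0n.
have n2 : 0 < n.+1%:R :> R by rewrite ltr0n.
have nf : 0 < n`!%:R :> R by rewrite ltr0n fact_gt0.
rewrite factS natrM lnM ?posrE//.
have : ln (n%:R / n.+1%:R) <= - n.+1%:R^-1 :> R.
  rewrite (le_trans (ln_le_subr1 (divr_gt0 n1 n2)))//.
  by move: n2; rewrite -natr1 => n2; rewrite le_eqVlt; apply/orP; left;
    apply/eqP; field; rewrite gt_eqF.
rewrite ln_div ?posrE// -(ler_pM2l n2) mulrN divff ?lt0r_neq0//.
move: n2; rewrite -natr1; nra.
Qed.

Lemma mult_ord0 N k (phi : 'I_k -> nat) :
  mult N phi ord0 = (N - \sum_(i < k) phi i)%N.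
Proof. by rewrite /mult unlift_none. Qed.

Lemma mult_lift N k (phi : 'I_k -> nat) i : mult N phi (lift ord0 i) = phi i.
Proof. by rewrite /mult liftK. Qed.

Lemma leq_sum_gt0 k (phi : 'I_k -> nat) :
  (forall j, 0 < phi j)%N -> (k <= \sum_(j < k) phi j)%N.
Proof.
move=> phi0; rewrite -[leqLHS]card_ord -sum1_card.
by apply: leq_sum => j _; exact: phi0.
Qed.

Lemma sum_ln_fact_mult_le (R : realType) (N k : nat) (phi : 'I_k -> nat) :
  (0 < k)%N -> (forall j, 0 < phi j)%N -> (\sum_(j < k) phi j <= N)%N ->
  \sum_(j < k.+1) (ln (mult N phi j)`!%:R
     - (mult N phi j)%:R * ln (mult N phi j)%:R + (mult N phi j)%:R)
  <= 3 * (k%:R * (1 + ln (N%:R / k%:R))) :> R.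
Proof.
move=> k0 phi0 sumN.
have kN : (k <= N)%N.
  exact: leq_trans (leq_sum_gt0 phi0) sumN.
have k0R : 0 < k%:R :> R by rewrite ltr0n.
have N0R : 0 < N%:R :> R by rewrite ltr0n (leq_trans k0).
apply: (@le_trans _ _ (\sum_(j < k.+1) (1 + ln (mult N phi j)%:R))).
  by apply: ler_sum => j _; exact: ln_fact_le.
rewrite big_ord_recl mult_ord0.
rewrite [X in _ + X <= _](eq_bigr (fun i => 1 + ln (phi i)%:R)); last first.
  by move=> i _; rewrite mult_lift.
set L := ln (N%:R / k%:R).
have L0 : 0 <= L by apply: ln_ge0; rewrite ler_pdivlMr// mul1r ler_nat.
have lnN : ln N%:R <= L + k%:R :> R.
  by rewrite /L ln_div ?posrE// -lerBlDl opprB addrCA subrr addr0 ltW// ln_sublinear.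
have h0 : ln (N - \sum_(i < k) phi i)%:R <= ln N%:R :> R.
  have [->|n0] := posnP (N - \sum_(i < k) phi i)%N.
    by rewrite ln0// ln_ge0// ler1n (leq_trans k0).
  by rewrite ler_ln ?posrE ?ltr0n// ?ler_nat ?leq_subr// (leq_trans k0).
have hs : \sum_(i < k) (1 + ln (phi i)%:R) <= k%:R * (1 + L).
  (* The logarithm is linearised at [N / k], so that the linear terms sum to at most [k]. *)
  apply: (@le_trans _ _ (\sum_(i < k) (L + (phi i)%:R * (k%:R / N%:R)))).
    apply: ler_sum => i _.
    have pi0 : 0 < (phi i)%:R :> R by rewrite ltr0n.
    have := @ln_le_subr1 R ((phi i)%:R / (N%:R / k%:R)).
    rewrite !divr_gt0// ln_div ?posrE ?divr_gt0// -/L invf_div => /(_ isT).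
    lra.
  rewrite big_split /= sumr_const card_ord -mulr_suml -natr_sum.
  rewrite -[L *+ k]mulr_natl mulrDr mulr1 addrC lerD2r mulrCA ger_pMr//.
  by rewrite ler_pdivrMr// mul1r ler_nat.
(* The class of frequency 0 costs at most [1 + L + k], the others together [k * (1 + L)]; as
   [1 <= k], the factor 3 covers both. *)
have k1 : 1 <= k%:R :> R by rewrite ler1n.
nra.
Qed.

(** Entries of [S] may vanish, so continuity of the entropy is needed at 0 too. On negative numbers
    the function is 0, as [ln] is. *)
Lemma continuous_xlnx (R : realType) : continuous (fun x : R => x * ln x).
Proof.
move=> x; have [x0|x0|->] := ltgtP x 0.
- apply: (@near_cst_continuous _ _ 0); near=> y.
  by rewrite ln0 ?mulr0// ltW//; near: y; exact: lt_nbhsl.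
- by apply: cvgM; [exact: cvg_id|exact: continuous_ln].
have s0 : (fun y : R => 2 * Num.sqrt y) @ 0 --> 0.
  rewrite -[X in _ --> X](mulr0 2) -[X in 2 * X](@sqrtr0 R).
  by apply: cvgM; [exact: cvg_cst|exact: sqrt_continuous].
rewrite /continuous_at mul0r.
(* [- 2 sqrt y <= y ln y] for [0 < y < 1], as [ln y = 2 ln (sqrt y)]. *)
apply: (@squeeze_cvgr _ _ _ _ (fun y : R => - (2 * Num.sqrt y))
  (fun y => 2 * Num.sqrt y)) => //.
  near=> y; have [y0|y0] := leP y 0.
    by rewrite ln0// mulr0 ler0_sqrtr// mulr0 oppr0 lexx.
  have y1 : y < 1 by near: y; exact: lt_nbhsl.
  have t0 : 0 < Num.sqrt y by rewrite sqrtr_gt0.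
  have lny : ln y <= 0 by rewrite ln_le0// ltW.
  have ty : y = Num.sqrt y * Num.sqrt y by rewrite -expr2 sqr_sqrtr// ltW.
  apply/andP; split; last by nra.
  have := @ln_le_subr1 R (Num.sqrt y)^-1.
  rewrite invr_gt0 t0 lnV ?posrE// => /(_ isT) H; rewrite {2 3}ty lnM ?posrE//.
  have : Num.sqrt y * (Num.sqrt y)^-1 = 1 by rewrite divff ?gt_eqF.
  nra.
by rewrite -[X in _ --> X]oppr0; exact: cvgN.
Unshelve. all: by end_near.
Qed.

(** * Counting permutations that induce a given assignment of classes *)

(** Such an [s] preserves every fibre of [J] and is determined by its restrictions to them, which
    embeds the stabiliser into a product of symmetric groups. *)
Lemma card_perm_stab (T K : finType) (J : T -> K) :
  (#|[set s : {perm T} | [forall x, J (s x) == J x]]%SET|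
     <= \prod_(j : K) (#|[set y | J y == j]%SET|)`!)%N.
Proof.
pose c j := [set y | J y == j]%SET.
pose h (s : {perm T}) : {ffun K -> {perm T}} := [ffun j => restr_perm (c j) s].
set B := [set s | _]%SET.
have nc s j : s \in B -> s \in ('N(c j | 'P))%g.
  rewrite inE => /forallP Js; rewrite inE /= !inE; apply/fintype.subsetP => x.
  by rewrite !inE /= /aperm (eqP (Js x)).
have hinj : {in B &, injective h}.
  move=> s t sB tB /ffunP hst; apply/permP => x.
  have := congr1 (fun p : {perm T} => p x) (hst (J x)).
  by rewrite !ffunE !restr_permE ?nc// !inE eqxx.
rewrite -(card_in_imset hinj).
have -> : (\prod_(j : K) (#|c j|)`! = #|family (fun j => mem (Sym (c j)))|)%N.
  rewrite card_family foldrE big_image /=.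
  by apply: eq_bigr => j _; rewrite card_Sym.
apply: subset_leq_card; apply/fintype.subsetP => _ /imsetP[s sB ->].
by apply/familyP => j; rewrite ffunE inE; exact: restr_perm_on.
Qed.

(** If the set contains some [s0], multiplying by the inverse of [s0] maps it injectively into the
    stabiliser of [J]. *)
Lemma card_perm_fibre (T K : finType) (J g : T -> K) :
  (#|[set s : {perm T} | [forall x, J (s x) == g x]]%SET|
     <= \prod_(j : K) (#|[set y | J y == j]%SET|)`!)%N.
Proof.
set A := [set s | _]%SET.
have [->|[s0 /[!inE]/forallP Js0]] := set_0Vmem A; first by rewrite cards0.
apply: leq_trans (card_perm_stab J).
rewrite -(card_imset _ (mulgI s0^-1%g)).
apply: subset_leq_card; apply/fintype.subsetP => _ /imsetP[s /[!inE]/forallP Js ->].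
by apply/forallP => x; rewrite permM (eqP (Js _)) -(eqP (Js0 _)) permKV.
Qed.

(** The term of [s] depends only on the assignment [x |-> J (s x)], and summing over all assignments
    expands the product of row sums. *)
Lemma permanent_block_le (R : realType) (D K : finType) (J : D -> K)
    (b : D -> K -> R) :
  (forall x j, 0 <= b x j) ->
  permanent (fun x y => b x (J y)) <=
    (\prod_(j : K) (#|[set y | J y == j]%SET|)`!)%:R * \prod_x \sum_j b x j.
Proof.
move=> b0; rewrite /permanent bigA_distr_bigA /= mulr_sumr.
rewrite (partition_big (fun s : {perm D} => [ffun x => J (s x)]) predT)//=.
apply: ler_sum => g _.
rewrite (eq_bigr (fun=> \prod_x b x (g x))); last first.
  by move=> s /eqP <-; apply: eq_bigr => x _; rewrite ffunE.
rewrite sumr_const -[leLHS]mulr_natl; apply: ler_wpM2r; first exact: prodr_ge0.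
rewrite ler_nat; apply: leq_trans (card_perm_fibre J g).
apply: subset_leq_card; apply/fintype.subsetP => s sg.
have <- : [ffun x => J (s x)] = g by exact/eqP.
by rewrite inE; apply/forallP => x; rewrite ffunE.
Qed.

(** * The entropy bound for the permanent *)

Lemma ln_prod (R : realType) (I : finType) (F : I -> R) :
  (forall i, 0 < F i) -> ln (\prod_i F i) = \sum_i ln (F i).
Proof.
move=> F0; suff [] : 0 < \prod_i F i /\ ln (\prod_i F i) = \sum_i ln (F i) by [].
elim/big_ind2 : _ => [|x1 x2 y1 y2 [x0 <-] [y0 <-]|i _]; first by rewrite ln1.
  by rewrite mulr_gt0// lnM.
by rewrite F0.
Qed.

(* Gibbs' inequality for the random permutation drawn proportionally to its
   term [w s] of the permanent, against the product measure with the same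
   one-point marginals [S i j / #|I^-1 i|]. *)
Lemma ln_permanent_le (R : realType) (D : finType) (l K : nat)
    (I : D -> 'I_l) (J : D -> 'I_K) (a : 'I_l -> 'I_K -> R) :
  (forall i j, 0 <= a i j) ->
  0 < permanent (fun x y => a (I x) (J y)) ->
  exists S : 'M[R]_(l, K),
    [/\ forall i j, 0 <= S i j,
        forall i, \sum_j S i j = #|[set x | I x == i]%SET|%:R,
        forall j, \sum_i S i j = #|[set y | J y == j]%SET|%:R,
        forall i j, a i j = 0 -> S i j = 0
      & ln (permanent (fun x y => a (I x) (J y))) <=
          \sum_i \sum_j S i j * ln (a i j / S i j)
          + \sum_i #|[set x | I x == i]%SET|%:R * ln #|[set x | I x == i]%SET|%:R
          + \sum_j ln (#|[set y | J y == j]%SET|)`!%:R].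
Proof.
move=> a0; set P := permanent _ => P0.
pose w (s : {perm D}) := \prod_x a (I x) (J (s x)).
pose p s := w s / P.
have w0 s : 0 <= w s by exact: prodr_ge0.
have p0 s : 0 <= p s by rewrite divr_ge0// ltW.
have p1 : \sum_s p s = 1 by rewrite -mulr_suml divff// gt_eqF.
pose S : 'M[R]_(l, K) := \matrix_(i, j)
  \sum_s p s * \sum_x ((I x == i) && (J (s x) == j))%:R.
have S0 i j : 0 <= S i j.
  by rewrite mxE; apply: sumr_ge0 => s _; rewrite mulr_ge0// sumr_ge0.
(* Linearity of expectation; indicators as [G] then yield the row and column sums. *)
have SE (G : 'I_l -> 'I_K -> R) :
    \sum_i \sum_j S i j * G i j = \sum_s p s * \sum_x G (I x) (J (s x)).
  under eq_bigr do under eq_bigr do rewrite mxE mulr_suml.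
  under eq_bigr do rewrite exchange_big.
  rewrite exchange_big; apply: eq_bigr => s _ /=.
  under eq_bigr do under eq_bigr do rewrite -mulrA.
  under eq_bigr do rewrite -mulr_sumr.
  rewrite -mulr_sumr; congr (_ * _).
  transitivity (\sum_i \sum_x \sum_j ((I x == i) && (J (s x) == j))%:R * G i j).
    apply: eq_bigr => i _; rewrite exchange_big; apply: eq_bigr => j _.
    by rewrite mulr_suml.
  rewrite exchange_big; apply: eq_bigr => x _ /=.
  rewrite (bigD1 (I x))//= (bigD1 (J (s x)))//= !eqxx mul1r.
  rewrite big1 ?addr0 => [|j /negPf jn]; last by rewrite eq_sym jn mul0r.
  rewrite big1 ?addr0// => i /negPf ni.
  by apply: big1 => j _; rewrite eq_sym ni mul0r.
have natE (T : finType) (B : pred T) :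
    \sum_x (B x)%:R = #|[set x | B x]%SET|%:R :> R.
  rewrite -sum1dep_card natr_sum [RHS]big_mkcond.
  by apply: eq_bigr => x _; case: (B x).
have rowS i : \sum_j S i j = #|[set x | I x == i]%SET|%:R.
  transitivity (\sum_i' \sum_j S i' j * (i' == i)%:R).
    rewrite (bigD1 i)//= [X in _ = _ + X]big1 ?addr0.
      by apply: eq_bigr => j _; rewrite eqxx mulr1.
    by move=> i' /negPf ni; apply: big1 => j _; rewrite ni mulr0.
  by rewrite SE -mulr_suml p1 mul1r natE.
have colS j : \sum_i S i j = #|[set y | J y == j]%SET|%:R.
  transitivity (\sum_i \sum_j' S i j' * (j' == j)%:R).
    apply: eq_bigr => i _; rewrite (bigD1 j)//= big1 ?addr0 ?eqxx ?mulr1//.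
    by move=> j' /negPf ->; rewrite mulr0.
  rewrite SE (eq_bigr (fun s => p s * #|[set y | J y == j]%SET|%:R)).
    by rewrite -mulr_suml p1 mul1r.
  move=> s _; congr (_ * _); rewrite -natE.
  by rewrite [RHS](reindex_perm s).
have Sa i j : a i j = 0 -> S i j = 0.
  move=> aij; rewrite mxE; apply: big1 => s _.
  have [/existsP[x /andP[/eqP Ix /eqP Jx]]|] :=
    boolP [exists x, (I x == i) && (J (s x) == j)].
    by rewrite /p /w (bigD1 x)//= Ix Jx aij !mul0r.
  rewrite negb_exists => /forallP n0.
  by rewrite big1 ?mulr0// => x _; rewrite (negPf (n0 x)).
exists S; split=> //.
pose c i : R := #|[set x | I x == i]%SET|%:R.
pose F : R := (\prod_j (#|[set y | J y == j]%SET|)`!)%:R.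
pose Q (s : {perm D}) := \prod_x (S (I x) (J (s x)) / c (I x)).
have c0 x : 0 < c (I x).
  by rewrite ltr0n; apply/card_gt0P; exists x; rewrite inE.
have F0 : 0 < F by rewrite ltr0n prodn_gt0// => j; rewrite fact_gt0.
have Q0 s : 0 <= Q s by apply: prodr_ge0 => x _; rewrite divr_ge0// ltW.
have sumQ : \sum_s Q s <= F.
  have := @permanent_block_le R D _ J (fun x j => S (I x) j / c (I x)).
  rewrite [X in _ * X]big1 ?mulr1.
    by apply=> x j; rewrite divr_ge0// ltW.
  by move=> x _; rewrite -mulr_suml rowS divff// (gt_eqF (c0 x)).
(* This is [ln t <= t - 1] at [t = Q s / (F * p s)], multiplied by [p s]. Summed over [s], the last
   bracket is at most 0 by [sumQ]. *)
have gibbs s : p s * ln P <=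
    p s * \sum_x ln (a (I x) (J (s x)) / (S (I x) (J (s x)) / c (I x)))
    + p s * ln F + (Q s / F - p s).
  have [ps0|ps0] := eqVneq (p s) 0.
    by rewrite ps0 !mul0r !add0r subr0 divr_ge0// ltW.
  have {}ps0 : 0 < p s by rewrite lt_def ps0 p0.
  have ws0 : 0 < w s by move: ps0; rewrite /p pmulr_lgt0// invr_gt0.
  have as0 x : 0 < a (I x) (J (s x)).
    rewrite lt_def a0 andbT; apply: contraTneq ws0 => ax.
    by rewrite /w (bigD1 x)//= ax mul0r ltxx.
  have Ss0 x : 0 < S (I x) (J (s x)).
    rewrite mxE; apply: lt_le_trans ps0 _.
    rewrite (bigD1 s)//= -[leLHS]addr0 lerD//.
      rewrite ler_peMr// (bigD1 x)//= !eqxx/= lerDl.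
      by apply: sumr_ge0.
    by apply: sumr_ge0 => s' _; rewrite mulr_ge0// sumr_ge0.
  have Qs0 : 0 < Q s by apply: prodr_gt0 => x _; rewrite divr_gt0.
  rewrite -ln_prod; last by move=> x; rewrite !divr_gt0.
  rewrite big_split /= prodfV -/(w s) -/(Q s).
  rewrite -mulrDr -lerBlDl -mulrBr.
  have -> : ln P - (ln (w s / Q s) + ln F) = ln (Q s / (F * p s)).
    have -> : P = w s / p s.
      by rewrite /p invf_div mulrCA divff ?mulr1// gt_eqF.
    have FP : 0 < F * p s by rewrite mulr_gt0.
    rewrite (ln_div ws0 ps0) (ln_div ws0 Qs0) (ln_div Qs0 FP) (lnM F0 ps0).
    ring.
  have -> : Q s / F - p s = p s * (Q s / (F * p s) - 1).
    by field; rewrite !gt_eqF.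
  by rewrite ler_pM2l// ln_le_subr1// divr_gt0// mulr_gt0.
have : \sum_s p s * ln P <= _ := ler_sum _ (fun s _ => gibbs s).
rewrite -mulr_suml p1 mul1r !big_split /= -mulr_suml p1 mul1r sumrN p1 -mulr_suml.
rewrite -(SE (fun i j => ln (a i j / (S i j / c i)))) => /le_trans; apply.
rewrite -[leRHS]addr0 lerD//; last by rewrite subr_le0 ler_pdivrMr// mul1r.
have -> : ln F = \sum_j ln (#|[set y | J y == j]%SET|)`!%:R.
  by rewrite /F natr_prod ln_prod// => j; rewrite ltr0n fact_gt0.
(* Each [S i j * ln (c i)] is split off; over a row these add up to [c i * ln (c i)]. *)
rewrite lerD2r -big_split /= ler_sum// => i _.
rewrite -/(c i) -{2}[c i]rowS mulr_suml -big_split /= ler_sum// => j _.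
have [->|Sij0] := eqVneq (S i j) 0; first by rewrite !mul0r addr0.
have aij0 : 0 < a i j.
  by rewrite lt_def a0 andbT; apply: contra_neq Sij0 => /Sa.
have Sij : 0 < S i j by rewrite lt_def Sij0 S0.
have ci0 : 0 < c i.
  rewrite /c -rowS (bigD1 j)//= -[ltLHS]addr0 ltr_leD// sumr_ge0//.
by rewrite !ln_div ?posrE ?divr_gt0// -mulrDr opprB addrA addrAC.
Qed.

(** * Existence of a maximiser of the objective *)

Section Maximizer.
Variables (R : realType) (D : finType) (l k : nat).
Variables (r : 'I_l -> R) (q : D -> R) (m phi : 'I_k -> nat).
Hypothesis r0 : forall i, 0 <= r i.

Let a i j := r i ^+ freq m j.

Let a0 i j : 0 <= a i j. Proof. exact: exprn_ge0. Qed.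

(** The part of [hfun] that is always finite; it is constant on [Zset], where the row sums are
    prescribed. *)
Definition margin_term (S : 'M[R]_(l, k.+1)) :=
  \sum_(i < l) (\sum_(j < k.+1) S i j) * ln (\sum_(j < k.+1) S i j)
  + \sum_(j < k.+1) (mult #|D| phi j)%:R * ln (mult #|D| phi j)%:R
  - \sum_(j < k.+1) (mult #|D| phi j)%:R.

(** Zero entries contribute 0 on both sides; at the others the support condition makes the argument
    of [lne] positive. *)
Lemma hfun_fin_num (S : 'M[R]_(l, k.+1)) :
  (forall i j, 0 <= S i j) -> (forall i j, r i ^+ freq m j = 0 -> S i j = 0) ->
  hfun D r m phi S =
    (\sum_(i < l) \sum_(j < k.+1) S i j * ln (r i ^+ freq m j / S i j)
     + margin_term S)%:E.
Proof.
move=> S0 Sa; rewrite /hfun /margin_term !addrA !EFinD; congr (_ + _ + _ + _)%E.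
rewrite -sumEFin; apply: eq_bigr => i _; rewrite -sumEFin; apply: eq_bigr => j _.
have [->|Sij0] := eqVneq (S i j) 0; first by rewrite mul0e mul0r.
have aij0 : 0 < a i j.
  by rewrite lt_def a0 andbT; apply: contra_neq Sij0 => /Sa.
by rewrite lne_EFin ?EFinM// divr_gt0// lt_def Sij0 S0.
Qed.

Lemma hfun_Ny (S : 'M[R]_(l, k.+1)) i j :
  (forall i j, 0 <= S i j) -> r i ^+ freq m j = 0 -> S i j != 0 ->
  hfun D r m phi S = -oo%E.
Proof.
move=> S0 aij Sij.
have Sij0 : 0 < S i j by rewrite lt_def Sij S0.
have ij : ((S i j)%:E * lne (r i ^+ freq m j / S i j)%:E = -oo)%E.
  by rewrite aij mul0r le0_lneNy// gt0_muleNy.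
rewrite /hfun (bigD1 i)//= (bigD1 j)//= -/(lne (r i ^+ freq m j / S i j)%:E) ij.
by rewrite !addNye.
Qed.

Lemma hfun_has_max :
  Zset r q phi !=set0 ->
  exists2 S, Zset r q phi S &
    forall S', Zset r q phi S' -> (hfun D r m phi S' <= hfun D r m phi S)%E.
Proof.
move=> [S1 ZS1].
pose supp := [set S : 'M[R]_(l, k.+1) | forall i j, a i j = 0 -> S i j = 0].
pose A := Zset r q phi `&` supp.
(* Off the support of [a] the objective is -oo, so it is maximised on the
   compact set [A], unless [A] is empty and every point is a maximiser. *)
have notA S : Zset r q phi S -> ~ A S -> hfun D r m phi S = -oo%E.
  move=> ZS nAS; case: (ZS) => S0 _ _.
  have [i [j [aij Sij]]] : exists i j, a i j = 0 /\ S i j != 0.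
    apply: contrapT => nex; apply: nAS; split=> // i j aij.
    by apply: contrapT => Sij; apply: nex; exists i, j; split=> //; exact/eqP.
  exact: hfun_Ny S0 aij Sij.
have [[S2 AS2]|nA] := pselect (A !=set0); last first.
  exists S1 => // S' ZS'; rewrite notA ?leNye// => AS'.
  by apply: nA; exists S'.
(* Matrices are flattened to row vectors, the setting of [rV_compact] and [EVT_max_rV]. *)
pose e (v : 'rV[R]_(l * k.+1)) i j := v ord0 (mxvec_index i j).
have eE v i j : e v i j = vec_mx v i j by rewrite /e mxE.
have ec i j : continuous (fun v => e v i j) by exact: coord_continuous.
have sumc (T : Type) (s : seq T) (F : T -> 'rV[R]_(l * k.+1) -> R) :
    (forall i, continuous (F i)) -> continuous (fun v => \sum_(i <- s) F i v).
  by move=> Fc; apply: continuous_big => //; exact: add_continuous.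
pose B : set 'rV[R]_(l * k.+1) := [set v | A (vec_mx v)].
(* Writing [ln (a / S)] as a difference makes [g] continuous everywhere; it agrees with [hfun] on
   [A]. *)
pose g v := \sum_i \sum_j (e v i j * ln (a i j) - e v i j * ln (e v i j))
  + margin_term (vec_mx v).
have xlnx_c (f : 'rV[R]_(l * k.+1) -> R) :
    continuous f -> continuous (fun v => f v * ln (f v)).
  by move=> fc v; exact: (continuous_comp (fc v) (@continuous_xlnx R (f v))).
have linc i j : continuous (fun v => e v i j * ln (a i j)).
  by move=> v; exact: (cvgM (@ec i j v) (cvg_cst _)).
have entc : continuous (fun v =>
    \sum_i \sum_j (e v i j * ln (a i j) - e v i j * ln (e v i j))).
  apply: (sumc _ _ (fun i v => _)) => i; apply: (sumc _ _ (fun j v => _)) => j v.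
  exact: (cvgB (@linc i j v) (@xlnx_c _ (@ec i j) v)).
have rowc i : continuous (fun v : 'rV[R]_(l * k.+1) => \sum_j vec_mx v i j).
  apply: (sumc _ _ (fun j v => vec_mx v i j)) => j.
  by rewrite (_ : (fun v => _) = fun v => e v i j)//; apply/funext => v; rewrite eE.
have rowlnc : continuous (fun v : 'rV[R]_(l * k.+1) =>
    \sum_i (\sum_j vec_mx v i j) * ln (\sum_j vec_mx v i j)).
  by apply: (sumc _ _ (fun i v => _)) => i; exact: xlnx_c (rowc i).
have gc : continuous g.
  move=> v; exact: (cvgD (entc v) (cvgB (cvgD (rowlnc v) (cvg_cst _)) (cvg_cst _))).
have gE S : A S -> hfun D r m phi S = (g (mxvec S))%:E.
  move=> [[S0 _ _] supS]; rewrite hfun_fin_num// /g mxvecK; congr (_ + _)%:E.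
  apply: eq_bigr => i _; apply: eq_bigr => j _; rewrite eE mxvecK.
  have [->|Sij0] := eqVneq (S i j) 0; first by rewrite !mul0r subr0.
  have aij0 : 0 < a i j.
    by rewrite lt_def a0 andbT; apply: contra_neq Sij0 => /supS.
  by rewrite ln_div ?posrE ?mulrBr// lt_def Sij0 S0.
have eq_closed (f : 'rV[R]_(l * k.+1) -> R) y : continuous f ->
    closed [set v | f v = y].
  by move=> /continuous_closedP fc; exact: (fc _ (@closed_eq _ y)).
have Bclosed : closed B.
  have -> : B = \bigcap_i \bigcap_j [set v | 0 <= e v i j]
    `&` \bigcap_i [set v | \sum_j e v i j = (level_size r q i)%:R]
    `&` \bigcap_j [set v | \sum_i e v i j = (mult #|D| phi j)%:R]
    `&` \bigcap_(ij in [set ij | a ij.1 ij.2 = 0]) [set v | e v ij.1 ij.2 = 0].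
    apply/seteqP; split=> v.
      move=> [[v0 vr vc] va]; split; [split; [split|]|].
      - by move=> i _ j _ /=; rewrite eE.
      - by move=> i _ /=; rewrite -vr; apply: eq_bigr => j _; rewrite eE.
      - by move=> j _ /=; rewrite -vc; apply: eq_bigr => i _; rewrite eE.
      - by move=> [i j] /= aij; rewrite eE va.
    move=> [[[v0 vr] vc] va]; split; [split|].
    - by move=> i j; rewrite -eE; exact: v0.
    - by move=> i; rewrite -[RHS](vr i I); apply: eq_bigr => j _; rewrite eE.
    - by move=> j; rewrite -[RHS](vc j I); apply: eq_bigr => i _; rewrite eE.
    - by move=> i j aij; rewrite -eE; exact: (va (i, j)).
  apply: closedI; [apply: closedI; [apply: closedI|]|].
  - apply: closed_bigI => i _; apply: closed_bigI => j _.
    exact: (proj1 (continuous_closedP _) (@ec i j) _ (@closed_ge R 0)).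
  - apply: closed_bigI => i _; apply: (eq_closed (fun v => \sum_j e v i j)).
    exact: (sumc _ _ (fun j v => e v i j)).
  - apply: closed_bigI => j _; apply: (eq_closed (fun v => \sum_i e v i j)).
    exact: (sumc _ _ (fun i v => e v i j)).
  - by apply: closed_bigI => ij _; exact: eq_closed.
(* An entry lies between 0 and its row sum, which is at most [#|D|]. *)
have Bcompact : compact B.
  apply: subclosed_compact Bclosed
    (rV_compact (A := fun=> `[0, #|D|%:R : R]%classic) _) _.
    by move=> _; exact: segment_compact.
  move=> v [[v0 vr _] _] p; case/mxvec_indexP: p => i j.
  rewrite /= in_itv /= -[v _ _]/(e v i j) eE v0 /=.
  apply: (@le_trans _ _ (level_size r q i)%:R); last by rewrite ler_nat max_card.
  rewrite -vr (bigD1 j)//= lerDl.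
  by apply: sumr_ge0.
have [||S3 /[!inE] BS3 S3max] := EVT_max_rV (f := g) _ Bcompact.
- by exists (mxvec S2); rewrite /B /= mxvecK.
- exact: continuous_subspaceT.
exists (vec_mx S3); first by case: BS3.
move=> S' ZS'; have [AS'|nAS'] := pselect (A S'); last by rewrite notA ?leNye.
rewrite !gE// lee_fin vec_mxK S3max// inE /B /= mxvecK//.
Qed.

End Maximizer.

(** * Frequency classes and assembly of the bound *)

Lemma freq_inj k (m : 'I_k -> nat) :
  injective m -> (forall j, 0 < m j)%N -> injective (freq m).
Proof.
move=> mI m0 i j; rewrite /freq.
case: (unliftP ord0 i) => [i' ->|->]; case: (unliftP ord0 j) => [j' ->|->] //.
- by move=> /mI ->.
- by move=> mi; move: (m0 i'); rewrite mi.
- by move=> mj; move: (m0 j'); rewrite -mj.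
Qed.

Lemma sum_mult N k (phi : 'I_k -> nat) :
  (\sum_(j < k) phi j <= N)%N -> (\sum_(j < k.+1) mult N phi j = N)%N.
Proof.
move=> sumN; rewrite big_ord_recl mult_ord0.
rewrite [X in (_ + X)%N](eq_bigr phi) ?subnK// => j _; exact: mult_lift.
Qed.

(** The fibres over distinct [c j] are disjoint, so a point outside all of them would leave at most
    [#|D| - 1] points to be counted. *)
Lemma fibre_cover (D K : finType) (T : eqType) (f : D -> T) (c : K -> T) :
  injective c -> (#|D| <= \sum_(j : K) #|[set y | f y == c j]%SET|)%N ->
  forall y, exists j, f y = c j.
Proof.
move=> cI cover y0; apply/existsPP; first by move=> j; exact: eqP.
apply: contraTT cover; rewrite negb_exists => /forallP n0; rewrite -ltnNge.
under eq_bigr do rewrite -sum1dep_card big_mkcond.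
rewrite exchange_big /= (bigD1 y0)//= big1 => [|j _]; last by rewrite (negPf (n0 j)).
rewrite add0n -[ltnRHS]sum1_card [ltnRHS](bigD1 y0)//= add1n ltnS.
apply: leq_sum => y _; rewrite -big_mkcond sum1dep_card cardsE.
apply/card_le1_eqP => i j; rewrite ?inE => /eqP fi /eqP fj.
by apply: cI; rewrite -fi -fj.
Qed.

(* With a fixed constant C, the bound C * k * ln (N / k) cannot hold for all
   1 <= k <= N: for N = k = 1, q = 1, f = 1 it is 0, while ln perm(A) = 0 and
   max h = -1.  The error term is therefore k * (1 + ln (N / k)) for all k >= 1,
   and literally k * ln (N / k) where the two are of the same order
   (2 * k <= N). *)
Theorem theorem6p4 (R : realType) :
  exists C : R, 0 < C /\
  forall (D : finType) (l k : nat)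
         (r : 'I_l -> R) (q : D -> R) (m phi : 'I_k -> nat) (f : D -> nat),
    (0 < k)%N ->
    injective r ->
    (forall i, 0 <= r i <= 1) ->
    (forall x, exists i, q x = r i) ->
    \sum_(x : D) q x <= 1 ->
    injective m ->
    (forall j, (0 < m j)%N) ->
    (forall j, (0 < phi j)%N) ->
    (\sum_(j < k) phi j <= #|D|)%N ->
    (forall j : 'I_k.+1,
        #|[set y : D | f y == freq m j]%SET| = mult #|D| phi j) ->
    exists S : 'M[R]_(l, k.+1),
      [/\ Zset r q phi S,
          forall S' : 'M[R]_(l, k.+1), Zset r q phi S' ->
            (hfun D r m phi S' <= hfun D r m phi S)%E,
          (lne (permanent (fun x y : D => q x ^+ f y))%:E
             <= (C * (k%:R * (1 + ln (#|D|%:R / k%:R))))%:E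
                + hfun D r m phi S)%E
        & (2 * k <= #|D|)%N ->
          (lne (permanent (fun x y : D => q x ^+ f y))%:E
             <= (C * (k%:R * ln (#|D|%:R / k%:R)))%:E
                + hfun D r m phi S)%E].
Proof.
have ln2 : 0 < ln 2 :> R by rewrite ln_gt0// ltr1n.
(* For [2 * k <= #|D|] one has [L >= ln 2], hence [1 + L <= (1 + (ln 2)^-1) * L]. *)
exists (3 * (1 + (ln 2)^-1)); split.
  by rewrite mulr_gt0// addr_gt0// invr_gt0.
move=> D l k r q m phi f k0 rI r01 qr _ mI m0 phi0 sumN cf.
have r0 i : 0 <= r i by case/andP: (r01 i).
have [I qI] := fin_all_exists qr.
have fI := freq_inj mI m0.
have card_cover : (#|D| <= \sum_j #|[set y | f y == freq m j]%SET|)%N.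
  by under eq_bigr do rewrite cf; rewrite sum_mult.
have [J fJ] := fin_all_exists (fibre_cover fI card_cover).
have cI i : level_size r q i = #|[set x | I x == i]%SET|.
  by apply: eq_card => x; rewrite !inE qI (inj_eq rI).
have cJ j : #|[set y | J y == j]%SET| = mult #|D| phi j.
  by rewrite -cf; apply: eq_card => y; rewrite !inE fJ (inj_eq fI).
have permE : permanent (fun x y => q x ^+ f y) =
    permanent (fun x y => r (I x) ^+ freq m (J y)).
  apply: eq_bigr => s _; by apply: eq_bigr => x _; rewrite qI fJ.
(* The witness counts the [x] of level [i] and class [j], the identity permutation's
   contribution. *)
have Zn0 : (Zset r q phi !=set0)%classic.
  exists (\matrix_(i, j) \sum_x ((I x == i) && (J x == j))%:R); split.
  - by move=> i j; rewrite mxE sumr_ge0.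
  - move=> i; under eq_bigr do rewrite mxE.
    rewrite exchange_big cI -sum1dep_card natr_sum [RHS]big_mkcond.
    apply: eq_bigr => x _; rewrite (bigD1 (J x))//= eqxx andbT big1 ?addr0.
      by case: eqP.
    by move=> j /negPf nj; rewrite [J x == j]eq_sym nj andbF.
  - move=> j; under eq_bigr do rewrite mxE.
    rewrite exchange_big -cJ -sum1dep_card natr_sum [RHS]big_mkcond.
    apply: eq_bigr => x _; rewrite (bigD1 (I x))//= eqxx big1 ?addr0.
      by case: eqP.
    by move=> i /negPf ni; rewrite eq_sym ni.
have [S ZS Smax] := hfun_has_max m r0 Zn0.
set L := ln (#|D|%:R / k%:R).
have main : (lne (permanent (fun x y : D => q x ^+ f y))%:E
    <= (3 * (k%:R * (1 + L)))%:E + hfun D r m phi S)%E.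
  rewrite permE; have [P0|P0] := leP (permanent (fun x y => r (I x) ^+ freq m (J y))) 0.
    by rewrite le0_lneNy ?leNye.
  have a0 i j : 0 <= r i ^+ freq m j by exact: exprn_ge0.
  have [S' [S'0 S'r S'c S'a S'P]] := ln_permanent_le a0 P0.
  have ZS' : Zset r q phi S'.
    by split=> // [i|j]; rewrite ?S'r ?S'c ?cI ?cJ.
  apply: le_trans (leeD2l _ (Smax _ ZS')).
  rewrite lne_EFin// hfun_fin_num// -EFinD lee_fin.
  (* After subtracting the value of [hfun] at [S'], only the Stirling error terms remain. *)
  apply: le_trans S'P _; rewrite -lerBlDr.
  apply: le_trans (sum_ln_fact_mult_le R k0 phi0 sumN).
  rewrite /margin_term !big_split /= sumrN.
  under [X in _ + X - _]eq_bigr do rewrite cJ.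
  under [X in _ - (_ + (X + _ - _))]eq_bigr do rewrite S'r.
  lra.
have kR : 0 < k%:R :> R by rewrite ltr0n.
have kD : (k <= #|D|)%N := leq_trans (leq_sum_gt0 phi0) sumN.
have DR : 0 < #|D|%:R :> R by rewrite ltr0n (leq_trans k0).
exists S; split=> //.
  apply: le_trans main _; apply: leeD2r; rewrite lee_fin ler_wpM2r//.
    apply: mulr_ge0; first exact: ltW.
    by apply: addr_ge0 => //; apply: ln_ge0; rewrite ler_pdivlMr// mul1r ler_nat.
  by rewrite mulrDr mulr1 lerDl mulr_ge0// invr_ge0 ltW.
move=> kN; apply: le_trans main _; apply: leeD2r; rewrite lee_fin.
have L2 : ln 2 <= L.
  by rewrite ler_ln ?posrE ?divr_gt0// ler_pdivlMr// -natrM ler_nat.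
rewrite -[leRHS]mulrA ler_pM2l// [leRHS]mulrCA ler_pM2l//.
rewrite [leRHS]mulrDl mul1r addrC lerD2l.
by rewrite mulrC ler_pdivlMr// mul1r.
Qed.
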